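(* Let $0\leq m_r\leq d_r$, $0\leq m_f\leq d_f$ satisfy $d_r\geq d_f-m_f$ and $d_f\geq d_r-m_r$, and let $\delta_r\geq0$, $\delta_f\geq0$. The following are equivalent: (a) for every $u\in S$, $Sol_{BDC}^{m_r,d_r,m_f,d_f}(u)\cap Sol_{AIC}^{\delta_r,\delta_f}\neq\emptyset$; (b) $\delta_r+\delta_f\leq m_r+m_f$.
   Context: $\mathbf{B}=\{0,1\}$ with Boolean operations $\cdot$ (and), complement $\overline{\ \cdot\ }$, ordered by $0<1$. $S$ is the set of signals: functions $x:\mathbb{R}\to\mathbf{B}$ for which there is a strictly increasing unbounded sequence $t_0<t_1<t_2<\dots$ of reals such that $x$ is constant on $(-\infty,t_0)$ and on each $[t_k,t_{k+1})$; for $x\in S$, $x(t-0)$ denotes the left limit of $x$ at $t$. For a bounded interval $I$ and $u\in S$, $\bigcap_{\xi\in I}u(\xi)$ equals $1$ iff $u(\xi)=1$ for all $\xi\in I$, and $\bigcup_{\xi\in I}u(\xi)$ equals $1$ iff $u(\xi)=1$ for some $\xi\in I$. For $0\leq m_r\leq d_r$, $0\leq m_f\leq d_f$ and $u\in S$, $Sol_{BDC}^{m_r,d_r,m_f,d_f}(u)$ is the set of $x\in S$ such that for all $t\in\mathbb{R}$: $\bigcap_{\xi\in[t-d_r,t-d_r+m_r]}u(\xi)\leq x(t)\leq\bigcup_{\xi\in[t-d_f,t-d_f+m_f]}u(\xi)$. For $\delta_r,\delta_f\geq0$, $Sol_{AIC}^{\delta_r,\delta_f}$ (absolute inertial condition)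 is the set of $x\in S$ such that for all $t\in\mathbb{R}$: $\overline{x(t-0)}\cdot x(t)\leq\bigcap_{\xi\in[t,t+\delta_r]}x(\xi)$ and $x(t-0)\cdot\overline{x(t)}\leq\bigcap_{\xi\in[t,t+\delta_f]}\overline{x(\xi)}$. *)

(* Defs.v *)
From mathcomp Require Import all_boot all_order all_algebra.
From mathcomp Require Import all_classical all_reals all_analysis.

Set Implicit Arguments.
Unset Strict Implicit.
Unset Printing Implicit Defensive.

Import Order.TTheory GRing.Theory Num.Theory.
Import numFieldNormedType.Exports.

Local Open Scope classical_set_scope.
Local Open Scope ring_scope.

Section Signals.
Context {R : realType}.
Implicit Types (x u : R -> bool) (t : R) (I : interval R).

Definition constant_on I x := {in I &, forall a b, x a = x b}.

Definition signal : set (R -> bool) :=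
  [set x | exists t_ : nat -> R,
    [/\ increasing_seq t_,
        ~ has_ubound (range t_),
        constant_on `]-oo, t_ 0%N[ x &
        forall k, constant_on `[t_ k, t_ k.+1[ x]].

(* x(t - 0), taken in the discrete topology of bool; it exists at every t
   when x is a signal. *)
Definition left_lim x t : bool := lim (x @ t^'-).

Definition bcap I x : bool := `[< forall xi, xi \in I -> x xi = true >].

Definition bcup I x : bool := `[< exists2 xi, xi \in I & x xi = true >].

Definition SolBDC (mr dr mf df : R) (u : R -> bool) : set (R -> bool) :=
  [set x | signal x /\ forall t,
    (bcap `[t - dr, t - dr + mr] u <= x t)%O /\
    (x t <= bcup `[t - df, t - df + mf] u)%O].

Definition SolAIC (deltar deltaf : R) : set (R -> bool) :=
  [set x | signal x /\ forall t,
    (~~ left_lim x t && x t <= bcap `[t, t + deltar] x)%O /\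
    (left_lim x t && ~~ x t <= bcap `[t, t + deltaf] (fun xi => ~~ x xi))%O].

End Signals.

(* Main.v *)
Require Import Defs.
From mathcomp Require Import all_boot all_order all_algebra lra.
From mathcomp Require Import all_classical all_reals all_analysis.

Import Order.TTheory GRing.Theory Num.Theory.
Import numFieldNormedType.Exports.

Local Open Scope classical_set_scope.
Local Open Scope ring_scope.

(** Sufficiency: call [a] a set event if [u] is 1 on [[a, a + mr]] and a reset
    event if [u] is 0 on [[a, a + mf]].  A set event followed by a reset event
    is more than [mr] earlier, and a reset event followed by a set event more
    than [mf] earlier.  Delaying set events by [A] and reset events by [B]
    changes these gaps to [mr - (A - B)] and [mf + (A - B)], so the latch driven
    by the delayed events satisfies the inertial condition as soon as
    [deltaf - mf <= A - B <= mr - deltar]; it satisfies the delay condition if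
    [df - mf <= A <= dr] and [dr - mr <= B <= df].  Such delays exist exactly
    when [deltar + deltaf <= mr + mf].

    Necessity: a pulse train whose high and low phases barely exceed [mr] and
    [mf] forces one rise and one fall per period, while the inertial condition
    spaces consecutive falls by more than [deltar + deltaf]. *)

(** * Boolean order, suprema, windows and left limits *)

Lemma lebP (a b : bool) : reflect (a -> b) (a <= b)%O.
Proof.
by rewrite leEbool; apply: (iffP idP); case: a; case: b => // /(_ isT).
Qed.

Lemma exists_lub {R : realType} (E : set R) (b : R) :
  E !=set0 -> (forall e, E e -> e <= b) ->
  exists s, [/\ s <= b, forall e, E e -> e <= s &
    forall a, a < s -> exists2 e, E e & a < e].
Proof.
move=> E0 Eb; exists (sup E); split.
- exact: ge_sup.
- by move=> e Ee; apply: ub_le_sup => //; exists b.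
- by move=> a; exact: sup_gt.
Qed.

Lemma bcapP {R : realType} (x : R -> bool) (a b : R) :
  reflect (forall s, a <= s <= b -> x s) (bcap `[a, b] x).
Proof.
by apply: (iffP (asboolP _)) => h s; have := h s; rewrite in_itv.
Qed.

Lemma bcupPn {R : realType} (x : R -> bool) (a b : R) :
  reflect (forall s, a <= s <= b -> ~~ x s) (~~ bcup `[a, b] x).
Proof.
apply: (iffP idP) => [/asboolPn h s ab|h].
  by apply/negP => xs; apply: h; exists s; rewrite ?in_itv.
by apply/asboolPn => -[s]; rewrite in_itv => /h /negP.
Qed.

Lemma left_lim_eq {R : realType} (x : R -> bool) (v : bool) (a t : R) :
  a < t -> (forall s, a < s < t -> x s = v) -> left_lim x t = v.
Proof.
move=> at_ xv; apply: cvg_lim; first exact: discrete_hausdorff.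
apply: cvg_near_cst; near=> s; apply: xv; apply/andP; split.
  by near: s; exact: nbhs_left_gt.
by near: s; exact: nbhs_left_lt.
Unshelve. all: by end_near. Qed.

(** * Signals as locally constant functions *)

Definition right_constant {R : realType} (x : R -> bool) (t : R) :=
  exists2 b, t < b & forall s, t <= s < b -> x s = x t.

Definition left_constant {R : realType} (x : R -> bool) (t : R) :=
  exists v a, a < t /\ forall s, a < s < t -> x s = v.

Definition initially_constant {R : realType} (x : R -> bool) :=
  exists v T, forall s, s < T -> x s = v.

(** A local form of [signal], which can be checked for shifts, windows and latches without merging
    breakpoint sequences. *)
Definition piecewise {R : realType} (x : R -> bool) :=
  [/\ initially_constant x, forall t, right_constant x t &
      forall t, left_constant x t].

Lemma signal_piecewise {R : realType} (x : R -> bool) :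
  signal x -> piecewise x.
Proof.
move=> [t_ [tinc tub x0 xk]].
have above t : exists n, t < t_ n.
  apply: contrapT => h; apply: tub; exists t => _ [n _ <-].
  by rewrite leNgt; apply/negP => tn; apply: h; exists n.
split.
- exists (x (t_ 0%N - 1)), (t_ 0%N) => s s0.
  by apply: x0; rewrite in_itv /= ?ltrBlDr ?ltrDl.
- move=> t; case: (ex_minnP (above t)) => n tn nmin.
  exists (t_ n) => // s /andP[ts sn]; case: n tn nmin sn => [|n] tn nmin sn.
    by apply: x0; rewrite in_itv /=.
  have nt : t_ n <= t by rewrite leNgt; apply/negP => /nmin; rewrite ltnn.
  by apply: (xk n); rewrite in_itv /= ?nt ?sn ?tn ?(le_trans nt ts).
(* The weak inequality matters: if [t] is itself a breakpoint, the interval needed is the one that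
   ends at [t]. *)
- move=> t; have ex : exists n, t <= t_ n by case: (above t) => n /ltW; exists n.
  case: (ex_minnP ex) => -[|n] tn nmin.
    exists (x (t - 1)), (t - 1); split; first by rewrite ltrBlDr ltrDl.
    by move=> s /andP[_ st]; apply: x0; rewrite in_itv /=; lra.
  have nt : t_ n < t by rewrite ltNge; apply/negP => /nmin; rewrite ltnn.
  exists (x (t_ n)), (t_ n); split=> // s /andP[ns st].
  by apply: (xk n); rewrite in_itv /= ?lexx; apply/andP; split; lra.
Qed.

(* The breakpoints are obtained greedily: the next one is as far as [x] stays
   constant, capped at distance one. *)
Lemma piecewise_signal {R : realType} (x : R -> bool) :
  piecewise x -> signal x.
Proof.
move=> [[v [T xT]] xr xl].
have step s : exists r, [/\ s < r, forall y, s <= y < r -> x y = x s &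
    forall r', r' <= s + 1 -> (forall y, s <= y < r' -> x y = x s) -> r' <= r].
  pose E := [set r | r <= s + 1 /\ forall y, s <= y < r -> x y = x s].
  have [b sb xb] := xr s.
  have Eb : E (Num.min b (s + 1)).
    split; first by rewrite ge_min lexx orbT.
    by move=> y; rewrite lt_min => /and3P[sy yb _]; apply: xb; rewrite sy.
  have [||r [_ rub rapp]] := @exists_lub _ E (s + 1).
  - by exists (Num.min b (s + 1)).
  - by move=> e [].
  exists r; split.
  - by apply: lt_le_trans (rub _ Eb); rewrite lt_min sb ltrDl ltr01.
  - by move=> y /andP[sy /rapp[e [_ xe] ye]]; apply: xe; rewrite sy.
  - by move=> r' r's xr'; apply: rub.
have [f fP] := choice step.
pose t_ n := iter n f T.
have tS n : t_ n < t_ n.+1 by case: (fP (t_ n)).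
have tinc : increasing_seq t_ by apply/increasing_seqP.
exists t_; split => //.
(* Bounded breakpoints would accumulate at some [L]; as [x] is constant just before [L], the greedy
   step from a breakpoint close to [L] would reach [L]. *)
- move=> [b bub].
  have [||L [_ Lub Lapp]] := @exists_lub _ (range t_) b.
  - by exists (t_ 0%N), 0%N.
  - by move=> e te; apply: bub.
  have tL n : t_ n < L by apply: lt_le_trans (tS n) _; apply: Lub; exists n.+1.
  have [w [a [aL xa]]] := xl L.
  have [|_ [n _ <-]] := Lapp (Num.max a (L - 1)).
    by rewrite gt_max aL ltrBlDr ltrDl ltr01.
  rewrite gt_max => /andP[an Ln].
  have [_ _ /(_ L)] := fP (t_ n); rewrite -[f _]/(t_ n.+1).
  have := tL n.+1; have := tL n => tn tSn H; suff : L <= t_ n.+1 by lra.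
  apply: H; first by lra.
  by move=> y /andP[ny yL]; rewrite (xa y) ?(xa (t_ n)) // ?an ?yL ?andbT //; lra.
- by move=> a b; rewrite !in_itv /= => aT bT; rewrite !xT.
- move=> k a b; rewrite !in_itv /= => ak bk.
  by case: (fP (t_ k)) => _ xk _; rewrite !xk.
Qed.

Lemma piecewise_neg {R : realType} (x : R -> bool) :
  piecewise x -> piecewise (fun t => ~~ x t).
Proof.
move=> [[v [T xT]] xr xl]; split.
- by exists (~~ v), T => s /xT ->.
- by move=> t; have [b tb xb] := xr t; exists b => // s /xb ->.
- move=> t; have [w [a [ta xa]]] := xl t.
  by exists (~~ w), a; split=> // s /xa ->.
Qed.

Lemma piecewise_shift {R : realType} (d : R) (x : R -> bool) :
  piecewise x -> piecewise (fun t => x (t - d)).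
Proof.
move=> [[v [T xT]] xr xl]; split.
- by exists v, (T + d) => s sT; apply: xT; lra.
- move=> t; have [b tb xb] := xr (t - d).
  by exists (b + d) => [|s sb]; [lra|apply: xb; lra].
- move=> t; have [w [a [ta xa]]] := xl (t - d).
  by exists w, (a + d); split=> [|s sa]; [lra|apply: xa; lra].
Qed.

Lemma piecewise_bcap {R : realType} (m : R) (x : R -> bool) : 0 <= m ->
  piecewise x -> piecewise (fun t => bcap `[t, t + m] x).
Proof.
move=> m0 [[v [T xT]] xr xl]; split.
- exists v, (T - m) => s sT; case: v xT => xT.
    by apply/bcapP => y sy; apply: xT; lra.
  apply/negP => /bcapP/(_ s); rewrite lexx lerDl m0 xT; last by lra.
  by move/(_ isT).
- move=> t; have [b tb xb] := xr t; have [c tc xc] := xr (t + m).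
  rewrite /right_constant /=; case: (boolP (bcap `[t, t + m] x)) => [/bcapP h|/asboolPn].
    exists (Num.min b (c - m)); first by rewrite lt_min tb; lra.
    move=> s; rewrite lt_min => sbc; apply/bcapP => y sy.
    have [ytm|tmy] := lerP y (t + m); first by apply: h; lra.
    by rewrite xc ?h //; lra.
  move=> /existsNP[y /not_implyP[]]; rewrite in_itv /= => ty /negP xy.
  have [yt|yt] := eqVneq y t.
    exists b => // s sb; apply/negP => /bcapP /(_ s).
    by rewrite (xb _ sb) -yt (negbTE xy) lexx lerDl m0 => /(_ isT).
  have ty' : t < y by rewrite lt_neqAle eq_sym yt; case/andP: ty.
  exists y => // s sy; apply/negP => /bcapP /(_ y).
  by rewrite (negbTE xy) => h; suff : false by []; apply: h; lra.
- move=> t; have [w [a [ta xa]]] := xl t.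
  case: w xa => xa; last first.
    exists false, a; split=> // s sa; apply/negP => /bcapP /(_ s).
    by rewrite lexx lerDl m0 xa // => /(_ isT).
  (* For [s < t] the window stops short of [t + m], hence the half-open interval. *)
  have [h|/existsNP[y /not_implyP[ty /negP xy]]] :=
    pselect (forall y, t <= y < t + m -> x y).
    exists true, a; split=> // s sa; apply/bcapP => y sy.
    by have [yt|ty] := ltrP y t; [apply: xa; lra|apply: h; lra].
  exists false, (Num.max a (y - m)); split; first by rewrite gt_max ta; lra.
  move=> s; rewrite gt_max => say; apply/negP => /bcapP /(_ y).
  by rewrite (negbTE xy) => h; suff : false by []; apply: h; lra.
Qed.

(** * Latches driven by set and reset events *)

(* The last event up to [t] is a [p]-event.  The sets of events need not contain
   a last element, hence the formulation by domination. *)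
Definition latch {R : realType} (p q : R -> bool) (t : R) : bool :=
  `[< exists2 a, a <= t /\ p a & forall b, b <= t -> q b -> b < a >].

Lemma latch_set {R : realType} (p q : R -> bool) (t : R) :
  (forall s, p s -> ~~ q s) -> p t -> latch p q t.
Proof.
move=> pq pt; apply/asboolP; exists t => // b bt qb.
by rewrite lt_neqAle bt andbT; apply: contraTneq qb => ->; exact: pq.
Qed.

Lemma latch_eq {R : realType} (p q : R -> bool) (s t : R) : s <= t ->
  (forall y, s < y <= t -> ~~ p y && ~~ q y) -> latch p q s = latch p q t.
Proof.
move=> st none; apply/idP/idP => /asboolP[a [ale pa] qa]; apply/asboolP.
  exists a; first by split=> //; lra.
  move=> b bt qb; have [bs|sb] := lerP b s; first exact: qa.
  by have := none b; rewrite sb bt qb andbF => /(_ isT).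
exists a; last by move=> b bs; apply: qa; lra.
split=> //; rewrite leNgt; apply/negP => sa.
by have := none a; rewrite sa ale pa => /(_ isT).
Qed.

(** Witnesses for both latches would each precede the other. For one to exist, take the supremum [s]
    of the events up to [t]: either an event occurs at [s], or events accumulate there from the
    left, and left constancy with disjointness lets only one kind do so. *)
Lemma latch_dual {R : realType} (p q : R -> bool) (t : R) :
  piecewise p -> piecewise q -> (forall s, p s -> ~~ q s) ->
  (forall T, exists2 s, s < T & p s || q s) ->
  latch q p t = ~~ latch p q t.
Proof.
move=> [_ _ pl] [_ _ ql] pq start.
apply/idP/idP => [/asboolP[b [bt qb] pb]|].
  apply/negP => /asboolP[a [at_ pa] qa].
  by have := qa b bt qb; have := pb a at_ pa; lra.
apply: contraNT => nqp.
have qp s : q s -> ~~ p s by apply: contraL => /pq.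
have [||s [st sub sapp]] := @exists_lub _ [set s | s <= t /\ p s || q s] t.
- by have [s0 s0t ev] := start t; exists s0; split=> //; exact: ltW.
- by move=> e [].
have none y : s < y <= t -> ~~ p y && ~~ q y.
  move=> /andP[sy yt]; rewrite -negb_or; apply/negP => ev.
  by have : y <= s by [apply: sub]; lra.
rewrite -(@latch_eq _ p q s) //.
move: nqp; rewrite -(@latch_eq _ q p s t) //; last first.
  by move=> y /none; rewrite andbC.
case: (boolP (p s)) => [ps _|nps]; first exact: latch_set.
case: (boolP (q s)) => [qs|nqs]; first by rewrite latch_set.
have [v [a [as_ pa]]] := pl s; have [w [b [bs qb]]] := ql s.
have [|y [yt ev]] := sapp (Num.max a b); first by rewrite gt_max as_.
rewrite gt_max => /andP[ay by_].
have ys : y < s.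
  rewrite lt_neqAle sub // andbT; apply/eqP => ys.
  by move: ev; rewrite ys (negbTE nps) (negbTE nqs).
have none_after (c : R) (z : R -> bool) : c < y -> ~~ z y -> ~~ z s ->
    (forall s', c < s' < s -> z s' = z y) ->
    forall b, b <= s -> z b -> b < y.
  move=> cy zy zs zc b' b's zb'; rewrite ltNge; apply/negP => yb'.
  have [b's'|ltb's] := eqVneq b' s; first by rewrite b's' (negbTE zs) in zb'.
  have {}ltb's : b' < s by rewrite lt_neqAle ltb's.
  by move: zb'; rewrite zc ?(negbTE zy) //; lra.
case/orP: ev => [py _|qy].
  apply/asboolP; exists y; first by split=> //; exact: ltW.
  apply: (none_after b) => //; first exact: pq.
  by move=> s' s'b; rewrite (qb y) ?by_ // qb.
move=> /negP; case; apply/asboolP; exists y; first by split=> //; exact: ltW.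
apply: (none_after a) => //; first exact: qp.
by move=> s' s'b; rewrite (pa y) ?ay // pa.
Qed.

Lemma piecewise_latch {R : realType} (p q : R -> bool) :
  piecewise p -> piecewise q -> (forall s, p s -> ~~ q s) ->
  (forall T, exists2 s, s < T & p s || q s) ->
  piecewise (latch p q).
Proof.
move=> pp pq_ pq start.
have dual t := latch_dual p q t pp pq_ pq start.
have qp s : q s -> ~~ p s by apply: contraL => /pq.
have rst s : q s -> latch p q s = false.
  by move=> qs; apply/negbTE; rewrite -dual; apply: latch_set.
case: pp pq_ => [[v [T pT]] pr pl] [[w [T' qT]] qr ql]; split.
(* An event this early means that [p] or [q] is constantly 1 near minus infinity, which fixes the
   latch there. *)
- have [s] := start (Num.min T T'); rewrite lt_min => /andP[sT sT'].
  rewrite (pT _ sT) (qT _ sT') => /orP[vt|wt].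
    by exists true, T => y yT; apply: latch_set; rewrite ?pT.
  by exists false, T' => y yT; apply: rst; rewrite qT.
- move=> t; have [b tb pb] := pr t; have [c tc qc] := qr t.
  case: (boolP (p t)) => [pt|npt].
    by exists b => // s sb; rewrite !latch_set ?pb.
  case: (boolP (q t)) => [qt|nqt].
    by exists c => // s sc; rewrite !rst ?qc.
  exists (Num.min b c); first by rewrite lt_min tb.
  move=> s; rewrite lt_min => /and3P[ts sb sc]; apply/esym/latch_eq => // y ys.
  by rewrite pb ?qc ?npt //; lra.
- move=> t; have [v' [a [at_ pa]]] := pl t; have [w' [b [bt qb]]] := ql t.
  case: v' pa => pa; first by exists true, a; split=> // s /pa; exact: latch_set.
  case: w' qb => qb; first by exists false, b; split=> // s /qb; exact: rst.
  pose m := Num.max a b; have mt : m < t by rewrite gt_max at_.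
  have none y : m < y < t -> ~~ p y && ~~ q y.
    by rewrite gt_max -andbA => /and3P[ay by_ yt]; rewrite pa ?qb ?ay ?by_.
  exists (latch p q ((m + t) / 2)), m; split=> // s ms.
  have [h|h] := lerP s ((m + t) / 2).
    by apply: latch_eq => // y ys; apply: none; lra.
  by apply/esym/latch_eq => [|y ys]; [lra|apply: none; lra].
Qed.

(** The witness lies strictly before [t] and works from then on; hence a latch rises only at a set
    event. *)
Lemma latch_edge {R : realType} (p q : R -> bool) (t : R) :
  latch p q t -> ~~ p t ->
  exists2 a, a < t & forall s, a < s < t -> latch p q s.
Proof.
move=> /asboolP[a [at_ pa] qa] npt; exists a.
  rewrite lt_neqAle at_ andbT; apply/eqP => at'.
  by move: npt; rewrite -at' pa.
move=> s as_; apply/asboolP; exists a; first by split=> //; lra.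
by move=> b bs; apply: qa; lra.
Qed.

Lemma latch_hold {R : realType} (p q : R -> bool) (d t s : R) :
  p t -> (forall b, q b -> t + d < b \/ b < t) -> t <= s <= t + d ->
  latch p q s.
Proof.
move=> pt sep ts; apply/asboolP; exists t; first by split=> //; lra.
by move=> b bs /sep; lra.
Qed.

Lemma latch_AIC {R : realType} (p q : R -> bool) (dr df : R) :
  0 <= dr -> 0 <= df ->
  piecewise p -> piecewise q ->
  (forall T, exists2 s, s < T & p s || q s) ->
  (forall a b, p a -> q b -> a + dr < b \/ b + df < a) ->
  SolAIC dr df (latch p q).
Proof.
move=> dr0 df0 pp qq start sep.
have pq s : p s -> ~~ q s.
  by move=> ps; apply/negP => qs; have := sep _ _ ps qs; lra.
have dual t := latch_dual p q t pp qq pq start.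
split; first exact/piecewise_signal/piecewise_latch.
move=> t; split; apply/lebP => /andP[lt xt]; apply/bcapP => s ts.
  have pt : p t.
    apply: contraNT lt => /(latch_edge _ _ _ xt)[a at_ xa].
    by rewrite (left_lim_eq _ true a).
  apply: (@latch_hold _ p q dr t s) => // b qb.
  by have [] := sep _ _ pt qb; [left|right; lra].
(* A fall of [latch p q] is a rise of [latch q p]. *)
rewrite -dual; rewrite -dual in xt.
have qt : q t.
  apply: contraLR lt => /(latch_edge _ _ _ xt)[a at_ xa].
  by rewrite (left_lim_eq _ false a) // => y /xa; rewrite dual => /negbTE.
apply: (@latch_hold _ q p df t s) => // a pa.
by have [] := sep _ _ pa qt; [right; lra|left].
Qed.

(** * Sufficiency: delays and the resulting solution *)

(** Over the allowed ranges [A - B] fills the interval from [- mf] to [mr], which contains the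
    target interval. Both choices below attain its right end [mr - deltar], with [B] or [A]
    minimal. *)
Lemma exists_delays {R : realType} (mr dr mf df deltar deltaf : R) :
  0 <= mr -> 0 <= mf -> df - mf <= dr -> dr - mr <= df ->
  0 <= deltar -> 0 <= deltaf -> deltar + deltaf <= mr + mf ->
  exists A B, [/\ df - mf <= A <= dr, dr - mr <= B <= df &
    deltaf - mf <= A - B <= mr - deltar].
Proof.
move=> *; have [h|h] := lerP (df - mf) (dr - deltar).
  by exists (dr - deltar), (dr - mr); split; lra.
by exists (df - mf), (df - mf - mr + deltar); split; lra.
Qed.

Lemma BDC_AIC_solvable {R : realType} (mr dr mf df deltar deltaf : R)
    (u : R -> bool) :
  0 <= mr -> 0 <= mf -> df - mf <= dr -> dr - mr <= df ->
  0 <= deltar -> 0 <= deltaf -> deltar + deltaf <= mr + mf -> signal u ->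
  SolBDC mr dr mf df u `&` SolAIC deltar deltaf !=set0.
Proof.
move=> mr0 mf0 hdr hdf r0 f0 le su.
have [A [B [hA hB hAB]]] :=
  exists_delays _ _ _ _ _ _ mr0 mf0 hdr hdf r0 f0 le.
have pu := signal_piecewise _ su.
pose p t := bcap `[t - A, t - A + mr] u.
pose q t := bcap `[t - B, t - B + mf] (fun s => ~~ u s).
have pp : piecewise p by exact: piecewise_shift (piecewise_bcap _ _ mr0 pu).
have pq : piecewise q.
  exact: piecewise_shift (piecewise_bcap _ _ mf0 (piecewise_neg _ pu)).
have sep a b : p a -> q b -> a - A + mr < b - B \/ b - B + mf < a - A.
  move=> /bcapP pa /bcapP qb.
  have [h|h] := ltrP (a - A + mr) (b - B); [by left|right].
  rewrite ltNge; apply/negP => h'.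
  (* The windows overlap, so [u] would be both 1 and 0 at the later of their starting points. *)
  have [ab|ab] := lerP (a - A) (b - B).
    have /negP[] : ~~ u (b - B) by apply: qb; lra.
    by apply: pa; lra.
  have /negP[] : ~~ u (a - A) by apply: qb; lra.
  by apply: pa; lra.
have start T : exists2 s, s < T & p s || q s.
  have [[v [T' uT]] _ _] := pu.
  pose m := Num.min T (Num.min (T' + A - mr) (T' + B - mf)).
  have : m - 1 < m by lra.
  rewrite {2}/m 2!lt_min => /and3P[mT mA mB]; exists (m - 1) => //.
  case: v uT => uT; apply/orP; [left|right]; apply/bcapP => s sm.
    by rewrite uT //; lra.
  by rewrite uT //; lra.
have sep' a b : p a -> q b -> a + deltar < b \/ b + deltaf < a.
  by move=> pa qb; have [] := sep _ _ pa qb; [left|right]; lra.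
have disj s : p s -> ~~ q s.
  by move=> ps; apply/negP => qs; have := sep' _ _ ps qs; lra.
exists (latch p q); split; last exact: latch_AIC.
split; first exact/piecewise_signal/piecewise_latch.
(* The set event at [t - dr] is seen by time [t] since [A <= dr], while [dr - mr <= B] delays every
   later reset event beyond [t]. The upper bound is the same argument for the dual latch. *)
move=> t; split; apply/lebP; first move=> h.
  apply/asboolP; exists (t - dr + A).
    by split; [lra|rewrite /p addrK].
  move=> b bt qb; have := sep (t - dr + A) b.
  by rewrite {1}/p addrK => /(_ h qb); lra.
apply: contraLR => /bcupPn h; rewrite -latch_dual //.
have qc : q (t - df + B) by apply/bcapP => s; rewrite addrK => /h.
apply/asboolP; exists (t - df + B); first by split=> //; lra.
by move=> a at_ pa; have := sep _ _ pa qc; lra.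
Qed.

(** * Necessity: transitions of a solution *)

(** At the supremum of the times up to which [x] stays 1, a value 1 would extend further by right
    constancy. *)
Lemma first_exit {R : realType} (x : R -> bool) (a b : R) :
  (forall t, right_constant x t) -> a < b -> x a -> ~~ x b ->
  exists t, [/\ a < t <= b, forall s, a < s < t -> x s & ~~ x t].
Proof.
move=> xr ab xa xb.
pose E := [set s | s <= b /\ forall y, a <= y < s -> x y].
have [||t [tb tub tapp]] := @exists_lub _ E b.
- by exists a; split=> [|y]; [exact: ltW|lra].
- by move=> e [].
have xt s : a <= s < t -> x s.
  by move=> /andP[as_ /tapp[e [_ xe] se]]; apply: xe; rewrite as_.
have at_ : a <= t by apply: tub; split=> [|y]; [exact: ltW|lra].
have nxt : ~~ x t.
  apply/negP => h; have [c tc xc] := xr t.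
  have tb' : t < b.
    by rewrite lt_neqAle tb andbT; apply: contraNneq xb => <-.
  suff : Num.min c b <= t by rewrite ge_min; lra.
  apply: tub; split; first by rewrite ge_min lexx orbT.
  move=> y; rewrite lt_min => /and3P[ay yc yb].
  by have [yt|ty] := ltrP y t; [apply: xt; lra|rewrite xc ?h // ty yc].
exists t; split=> // [|s as_]; last by apply: xt; lra.
by rewrite tb andbT lt_neqAle at_ andbT; apply: contraNneq nxt => <-.
Qed.

Lemma AIC_fall {R : realType} (dr df : R) (x : R -> bool) (a b : R) :
  SolAIC dr df x -> a < b -> x a -> ~~ x b ->
  exists2 t, a < t <= b & forall s, t <= s <= t + df -> ~~ x s.
Proof.
move=> [/signal_piecewise[_ xr _] aic] ab xa xb.
have [t [tab xt nxt]] := first_exit x a b xr ab xa xb.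
exists t => //; apply/bcapP; have [_ /lebP] := aic t; apply.
by rewrite nxt andbT (left_lim_eq _ true a) //; case/andP: tab.
Qed.

Lemma AIC_rise {R : realType} (dr df : R) (x : R -> bool) (a b : R) :
  SolAIC dr df x -> a < b -> ~~ x a -> x b ->
  exists2 t, a < t <= b & forall s, t <= s <= t + dr -> x s.
Proof.
move=> [/signal_piecewise/piecewise_neg[_ xr _] aic] ab xa xb.
have [|t [tab xt nxt]] := first_exit _ a b xr ab xa; first by rewrite negbK.
exists t => //; apply/bcapP; have [/lebP + _] := aic t; apply.
rewrite (left_lim_eq _ false a) /= ?(negbNE nxt) //; first by case/andP: tab.
by move=> s /xt /negbTE.
Qed.

(** * Necessity: pulse trains *)

(** With [k] natural and [p], [q] positive the train is 0 before time 0, so it is constant near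
    minus infinity. *)
Definition pulse_train {R : realType} (p q t : R) : bool :=
  `[< exists k : nat, k%:R * (p + q) <= t < k%:R * (p + q) + p >].

Lemma pulse_train_on {R : realType} (p q t : R) (k : nat) :
  k%:R * (p + q) <= t < k%:R * (p + q) + p -> pulse_train p q t.
Proof. by move=> kt; apply/asboolP; exists k. Qed.

Lemma pulse_train_off {R : realType} (p q t : R) (k : nat) :
  0 < p -> 0 < q ->
  k%:R * (p + q) + p <= t < k.+1%:R * (p + q) -> ~~ pulse_train p q t.
Proof.
move=> p0 q0 kt; apply/asboolPn => -[j jt].
have [jk|kj] := leqP j k.
  have : j%:R * (p + q) <= k%:R * (p + q) by rewrite ler_wpM2r ?ler_nat //; lra.
  lra.
have : k.+1%:R * (p + q) <= j%:R * (p + q) by rewrite ler_wpM2r ?ler_nat //; lra.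
lra.
Qed.

Lemma pulse_train_signal {R : realType} (p q : R) :
  0 < p -> 0 < q -> signal (pulse_train p q).
Proof.
move=> p0 q0; have L0 : 0 < p + q by lra.
pose t_ n : R := n./2%:R * (p + q) + (if odd n then p else 0).
have tS n : t_ n.+1 = if odd n then n./2.+1%:R * (p + q)
                      else n./2%:R * (p + q) + p.
  by rewrite /t_ /= uphalf_half; case: (odd n) => /=; rewrite ?addr0 ?add1n ?add0n.
exists t_; split.
- apply/increasing_seqP => n; rewrite tS /t_; case: (odd n); last by lra.
  by rewrite -natr1; lra.
- move=> [b bub]; pose k := Num.bound `|b / (p + q)|.
  have : t_ k.*2 <= b by apply: bub; exists k.*2.
  rewrite /t_ doubleK odd_double addr0 leNgt => /negP; apply.
  rewrite -ltr_pdivrMr //; apply: le_lt_trans (ler_norm _) _.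
  exact/archi_boundP/normr_ge0.
- have off s : s < t_ 0%N -> pulse_train p q s = false.
    rewrite /t_ /= mul0r addr0 => s0; apply/negbTE/asboolPn => -[k ks].
    by have : 0 <= k%:R * (p + q) by [rewrite mulr_ge0 ?ler0n ?ltW]; lra.
  by move=> a b; rewrite !in_itv /= => /off -> /off ->.
- move=> n a b; rewrite !in_itv /= tS /t_.
  case: (odd n) => na nb.
    by rewrite !(negbTE (pulse_train_off _ _ _ n./2 _ _ _)).
  by rewrite !(pulse_train_on _ _ _ n./2) //; lra.
Qed.

(* Successive falls of a solution are more than [deltar + deltaf] apart, while
   the pulse train forces one fall per period [p + q]. *)
Lemma pulse_train_period_ge {R : realType} (mr dr mf df deltar deltaf p q : R)
    (x : R -> bool) :
  0 <= mr -> 0 <= mf -> df - mf <= dr -> dr - mr <= df ->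
  mr < p -> mf < q -> 0 <= deltar -> 0 <= deltaf ->
  SolBDC mr dr mf df (pulse_train p q) x -> SolAIC deltar deltaf x ->
  deltar + deltaf <= p + q.
Proof.
move=> mr0 mf0 hdr hdf mp mq r0 f0 [_ bdc] aic.
(* As [mr < p] and [mf < q], the windows of the delay condition fit into the high and low phases and
   force these values. *)
have xon (k : nat) : x (k%:R * (p + q) + dr).
  have [/lebP + _] := bdc (k%:R * (p + q) + dr); apply; apply/bcapP => s ks.
  by apply: (pulse_train_on _ _ _ k); lra.
have xoff (k : nat) : ~~ x (k%:R * (p + q) + p + df).
  have [_ /lebP/contraNN] := bdc (k%:R * (p + q) + p + df); apply.
  apply/bcupPn => s ks; apply: (pulse_train_off _ _ _ k); first by lra.
    by lra.
  by rewrite -natr1; lra.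
rewrite leNgt; apply/negP => lt.
(* The first two bounds follow the period; the third drifts, as the hold times [deltaf] and [deltar]
   both elapse before the next fall. *)
have falls (k : nat) : exists2 f,
    [/\ k%:R * (p + q) + dr < f, f <= k%:R * (p + q) + p + df &
        dr + k%:R * (deltar + deltaf) <= f] &
    forall s, f <= s <= f + deltaf -> ~~ x s.
  elim: k => [|k [f [f1 f2 f3] fx]].
    have [|f fab fx] := AIC_fall _ _ _ _ _ aic _ (xon 0%N) (xoff 0%N); first lra.
    by exists f => //; split; lra.
  have [|r rab rx] := AIC_rise _ _ _ _ _ aic _ (xoff k) (xon k.+1).
    by rewrite -natr1; lra.
  have [|g gab gx] := AIC_fall _ _ _ _ _ aic _ (xon k.+1) (xoff k.+1); first lra.
  have fr : f + deltaf < r.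
    rewrite ltNge; apply/negP => rf.
    have /negP[] : ~~ x r by apply: fx; lra.
    by apply: rx; lra.
  exists g => //; split; [lra|lra|].
  have rg : r + deltar < g.
    rewrite ltNge; apply/negP => gr.
    have /negP[] : ~~ x g by apply: gx; lra.
    by apply: rx; lra.
  by rewrite -natr1; lra.
(* The bounds on the [k]-th fall give [k * e <= c], which fails for large [k]. *)
pose c := p + df - dr; pose e := deltar + deltaf - (p + q).
have e0 : 0 < e by rewrite /e; lra.
have : `|c / e| < (Num.bound `|c / e|)%:R by exact/archi_boundP/normr_ge0.
move=> /(le_lt_trans (ler_norm _)); rewrite ltr_pdivrMr // /c /e.
by have [f [_ f2 f3] _] := falls (Num.bound `|c / e|); lra.
Qed.

Theorem theorem3p4 (R : realType) (mr dr mf df deltar deltaf : R)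
  (hmr : 0 <= mr) (hmrdr : mr <= dr) (hmf : 0 <= mf) (hmfdf : mf <= df)
  (hdr : df - mf <= dr) (hdf : dr - mr <= df)
  (hdeltar : 0 <= deltar) (hdeltaf : 0 <= deltaf) :
  (forall u : R -> bool, signal u ->
     SolBDC mr dr mf df u `&` SolAIC deltar deltaf !=set0) <->
  deltar + deltaf <= mr + mf.
Proof.
split=> [sol|le u]; last exact: BDC_AIC_solvable.
rewrite leNgt; apply/negP => lt.
(* A quarter of the excess keeps the period [mr + mf + 2 * e] below [deltar + deltaf]. *)
pose e := (deltar + deltaf - (mr + mf)) / 4.
have e0 : 0 < e by rewrite /e; lra.
have [|x [bdc aic]] := sol (pulse_train (mr + e) (mf + e)).
  by apply: pulse_train_signal; lra.
have : deltar + deltaf <= mr + e + (mf + e).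
  by apply: pulse_train_period_ge bdc aic; lra.
by rewrite /e; lra.
Qed.
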